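(* Let $KB=(O,M)$ be a tightly coupled probabilistic $\mathcal{EL}^{++}$ ontology (TCP ontology) where $M$ is a ground conjunctive Markov logic network with $n$ ground atoms, and let $C_1,\dots,C_{2^{|M|}}$ be the equivalence classes of $M$ sorted in decreasing order of their score. Let $out$ be the output of Algorithm anytimeRank on $KB$ (atoms $a$ paired with their scores $s_a$), and let $U$ be the bound on the unassigned score mass after analyzing $s$ worlds and $t$ classes with the algorithm, namely $$U=(2^n-s)\cdot\exp\Bigl(\sum_{F_j\in M,\ C_{t+1}\models F_j}w_j\Bigr).$$ The partial order $\leq_U$ defined as: $a\leq_U b$ iff $s_a+U\le s_b$, where $(a,s_a),(b,s_b)\in out$, is such that if $a\leq_U b$ then $\Pr^{KB}(a)\le\Pr^{KB}(b)$.
   Context: **$\mathcal{EL}^{++}$.** Concepts are built from pairwise disjoint sets of atomic concept names, role names and individual names $\mathbf I$ by $\top$, $\bot$, nominals $\{a\}$, conjunction $C\sqcap D$, existential restriction $\exists r.C$, and concrete domain concepts $p(f_1,\dots,f_k)$ ($p$ a predicate of a concrete domain, $f_i$ feature names interpreted as partial functions into the concrete domains, which are pairwise disjoint), with the usual semantics. A TBox is a finite set of general concept inclusions $C\sqsubseteq D$, role inclusions $r_1\circ\cdots\circ r_k\sqsubseteq r$, domain restrictions $dom(r)\sqsubseteq C$ and range restrictions $ran(r)\sqsubseteq C$; an ABox is a finite set of assertions $C(a)$, $r(a,b)$. The syntactic restriction of Baader, Brandt and Lutz (2008), which prevents intricate interplay between role inclusions and range restrictions, is assumed. Axioms and assertions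 are identified with their first-order translations. **Ground cMLN and classes.** Let $\mathcal R_{MLN}$ (finite, disjoint from concept and role names), $\Delta_{MLN}$ (finite) and $\mathcal V_{MLN}$ be the predicate names, constants and variables of the Markov logic network (MLN). A ground conjunctive Markov logic network (ground cMLN) is a finite set $M$ of pairs $(F_j,w_j)$, each $F_j$ a conjunction of ground atoms over $\mathcal R_{MLN},\Delta_{MLN}$ and $w_j\in\mathbb R$; $|M|$ is the number of formulas. $X$ is the set of ground atoms over $\mathcal R_{MLN}$ and $\Delta_{MLN}$, regarded as Boolean random variables. A (possible) world is a truth assignment $\lambda$ to $X$, regarded also as the set of pairs $\langle X_i,\lambda(X_i)\rangle$. Its probability is $\Pr_M(\lambda)=\frac1Z\exp(\sum_{j:\lambda\models F_j}w_j)$ with $Z=\sum_{\lambda'}\exp(\sum_{j:\lambda'\models F_j}w_j)$. Two worlds are equivalent iff they satisfy the same formulas of $M$. Thus each subset $T$ of the formulas of $M$ determines an equivalence class $C$ (possibly empty), consisting of the worlds that satisfy exactly the formulas in $T$; there are $2^{|M|}$ such classes. Write $C\models F_j$ iff $F_j\in T$. The score of $C$ is $\exp(\sum_{F_j\in M,\,C\models F_j}w_j)$. **TCP ontologies.** A probabilistic annotation $\mu$ is a finite set of pairs $\langle A_i,x_i\rangle$, with $A_i$ an atom over $\mathcal R_{MLN},\mathcal V_{MLN},\Delta_{MLN}$ and $x_i\in\{0,1\}$, the atoms of any two pairs not being unifiable. A TCP ontology is $KB=(O,M)$, where $O$ is a set of annotated formulas $F:\mu$ with $F$ the first-order translation of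 an $\mathcal{EL}^{++}$ axiom or assertion; variables and constants may be shared between $F$ and $\mu$. For a world $\lambda$, the induced (non-probabilistic) ontology is $O_\lambda=\{\theta F\mid F:\mu\in O,\ \theta\mu\subseteq\lambda\}$, where $\theta$ is a most general unifier for $\lambda$ and $\mu$. **Semantics.** An interpretation is $\langle D,w\rangle$ with $D$ a database (a set of ground atoms over $\mathbf I$ together with a set $\Delta_N$ of labeled nulls) and $w$ a world. It satisfies $F:\mu$ iff, whenever there is a most general unifier $\theta$ such that for all $\langle V_i,x_i\rangle\in\mu$ the atom $\theta V_i$ is a variable $X_i\in X$ to which $w$ assigns the value $x_i$, then $D\models\theta F$. A probabilistic interpretation $Pr$ is a probability distribution over interpretations with only finitely many interpretations mapped to non-zero values; $Pr(F:\mu)$ is the sum of $Pr(\mathcal I)$ over interpretations $\mathcal I$ satisfying $F:\mu$. $Pr\models KB$ iff (i) $Pr(F:\mu)=1$ for every $F:\mu\in O$, and (ii) $1-Pr(\mathit{false}:\lambda)=\Pr_M(\lambda)$ for every world $\lambda$. For a ground atom $a$ constructed from predicates and individuals in $KB$, $\Pr^{KB}(a)$ is the infimum of $Pr(a:\{\})$ over all $Pr$ with $Pr\models KB$. (Intuitively, it is the sum of the probabilities of all worlds $\lambda$ such that $O_\lambda$ entails $a$.) **Algorithm anytimeRank.** Given $KB$ and a user-chosen stopping condition, it processes the classes in the order $C_1,C_2,\dots,C_{2^{|M|}}$ (decreasing score). Within each class it goes through the worlds one at a time, each once; for each inspected world $\lambda\in C_i$ it computes $O_\lambda$, adds the score of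 $C_i$ to $score(a)$ (initially $0$) for every atom $a$ that is an atomic consequence of $O_\lambda$, and adds these atoms to $out$. It stops when all classes are processed or the stopping condition holds, and returns the atoms in $out$ sorted in decreasing order of score, with $s_a=score(a)$. The unassigned score mass is the total class score that the algorithm has not yet assigned when it stops; $U$ is an upper bound on it.
   Formalization: As defined, ≤_U is not reflexive when U>0 and not antisymmetric on atoms with tied scores when U=0; ''partial order'' is replaced by: transitive, irreflexive if U>0, reflexive on out if U=0, antisymmetric up to equal scores. *)

(* Defs.v *)
From HB Require Import structures.
From mathcomp Require Import all_boot all_order all_algebra finmap.
From mathcomp Require Import all_classical all_reals all_analysis.

Set Implicit Arguments.
Unset Strict Implicit.
Unset Printing Implicit Defensive.

Import Order.TTheory GRing.Theory Num.Theory.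
Local Open Scope ring_scope.
Local Open Scope classical_set_scope.

Record concrete_domain := ConcreteDomain {
  cd_val : Type;
  cd_pred : Type;
  cd_ar : cd_pred -> nat;
  cd_ext : forall p : cd_pred, (cd_ar p).-tuple cd_val -> Prop }.

(* The different sorts of names live in different types, hence are disjoint.
   Ontology constants and Markov logic constants share the universe [const],
   since a constant may occur both in an axiom and in its annotation: [indiv]
   is the set I of individual names, [mconst] the finite set Delta_MLN.
   Variables, those of V_MLN included, are natural numbers. *)
Record signature := Signature {
  cname : choiceType;
  rname : choiceType;
  fname : Type;
  const : choiceType;
  indiv : pred const;
  null : Type;
  cdom : finType;
  cd : cdom -> concrete_domain;
  mpred : finType;
  mar : mpred -> nat;
  mconst : {fset const} }.

Section Syntax.
Variable S : signature.

Inductive concept :=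
| CTop
| CBot
| CName of cname S
| CNom of const S
| CAnd of concept & concept
| CEx of rname S & concept
| CPred (j : cdom S) (p : cd_pred (cd j)) of (cd_ar p).-tuple (fname S).

(* [RI [::] r] is the inclusion of the empty composition (the identity) in r,
   i.e. reflexivity of r. *)
Inductive axiom :=
| GCI of concept & concept
| RI of seq (rname S) & rname S
| Dom of rname S & concept
| Ran of rname S & concept
| AConcept of concept & const S
| ARole of rname S & const S & const S.

HB.instance Definition _ := gen_eqMixin axiom.
HB.instance Definition _ := gen_choiceMixin axiom.

Fixpoint concept_cnames (C : concept) : seq (cname S) :=
  match C with
  | CName A => [:: A]
  | CAnd C D => concept_cnames C ++ concept_cnames D
  | CEx _ C => concept_cnames C
  | _ => [::]
  end.

Fixpoint concept_rnames (C : concept) : seq (rname S) :=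
  match C with
  | CAnd C D => concept_rnames C ++ concept_rnames D
  | CEx r C => r :: concept_rnames C
  | _ => [::]
  end.

Fixpoint concept_consts (C : concept) : seq (const S) :=
  match C with
  | CNom a => [:: a]
  | CAnd C D => concept_consts C ++ concept_consts D
  | CEx _ C => concept_consts C
  | _ => [::]
  end.

Definition axiom_cnames (ax : axiom) : seq (cname S) :=
  match ax with
  | GCI C D => concept_cnames C ++ concept_cnames D
  | RI _ _ | ARole _ _ _ => [::]
  | Dom _ C | Ran _ C | AConcept C _ => concept_cnames C
  end.

Definition axiom_rnames (ax : axiom) : seq (rname S) :=
  match ax with
  | GCI C D => concept_rnames C ++ concept_rnames D
  | RI rs r => r :: rs
  | Dom r C | Ran r C => r :: concept_rnames C
  | AConcept C _ => concept_rnames C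
  | ARole r _ _ => [:: r]
  end.

Definition axiom_consts (ax : axiom) : seq (const S) :=
  match ax with
  | GCI C D => concept_consts C ++ concept_consts D
  | RI _ _ => [::]
  | Dom _ C | Ran _ C => concept_consts C
  | AConcept C a => a :: concept_consts C
  | ARole _ a b => [:: a; b]
  end.

(* The restriction of Baader, Brandt and Lutz (2008): T |= r [= s holds if s is
   reachable from r through role inclusions of length one in T;
   T |= ran(r) [= C if T |= r [= s and ran(s) [= C is in T, for some s; and
   whenever r_1 o ... o r_n [= s is in T, n >= 1, and T |= ran(s) [= C, then
   T |= ran(r_n) [= C. *)
Inductive subrole (T : set axiom) : rname S -> rname S -> Prop :=
| subrole_refl r : subrole T r r
| subrole_step r r' s : T (RI [:: r] r') -> subrole T r' s -> subrole T r s.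

Definition has_range (T : set axiom) (r : rname S) (C : concept) : Prop :=
  exists2 s, subrole T r s & T (Ran s C).

Definition range_restriction (T : set axiom) : Prop :=
  forall (rs : seq (rname S)) (rn s : rname S) (C : concept),
    T (RI (rcons rs rn) s) -> has_range T s C -> has_range T rn C.

Definition term := (nat + const S)%type.

(* Free variables are implicitly universally quantified.  [FPred fs t] stands
   for "the features fs are defined at t and their values satisfy p". *)
Inductive fo :=
| FTrue
| FFalse
| FConcept of cname S & term
| FRole of rname S & term & term
| FEq of term & term
| FPred (j : cdom S) (p : cd_pred (cd j)) of
    (cd_ar p).-tuple (fname S) & term
| FAnd of fo & fo
| FImp of fo & fo
| FEx of nat & fo.

(* Translation of C at the term t in a premise.  Since (exists y, P y) -> Q is
   equivalent to forall y, P y -> Q, the variables of existential restrictions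
   are left free, taken from k on, so that an annotation can share them.
   The second component is the first unused variable. *)
Fixpoint tr_body (C : concept) (t : term) (k : nat) : fo * nat :=
  match C with
  | CTop => (FTrue, k)
  | CBot => (FFalse, k)
  | CName A => (FConcept A t, k)
  | CNom a => (FEq t (inr a), k)
  | CAnd C D =>
      let: (phi, k1) := tr_body C t k in
      let: (psi, k2) := tr_body D t k1 in
      (FAnd phi psi, k2)
  | CEx r C =>
      let: (phi, k1) := tr_body C (inl k) k.+1 in
      (FAnd (FRole r t (inl k)) phi, k1)
  | CPred _ _ fs => (FPred fs t, k)
  end.

(* Translation of C at t in a conclusion, with bound variables from k on. *)
Fixpoint tr_head (C : concept) (t : term) (k : nat) : fo :=
  match C with
  | CTop => FTrue
  | CBot => FFalse
  | CName A => FConcept A t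
  | CNom a => FEq t (inr a)
  | CAnd C D => FAnd (tr_head C t k) (tr_head D t k)
  | CEx r C => FEx k (FAnd (FRole r t (inl k)) (tr_head C (inl k) k.+1))
  | CPred _ _ fs => FPred fs t
  end.

Fixpoint tr_chain (rs : seq (rname S)) (i : nat) : fo :=
  if rs is r :: rs'
  then FAnd (FRole r (inl i) (inl i.+1)) (tr_chain rs' i.+1)
  else FTrue.

(* The names of the free variables are fixed once and for all (0 for the
   instance of the left-hand concept of a GCI, 0 and 1 for the pair of a domain
   or range restriction, 0, ..., k along a role chain); this loses nothing, as
   the variables of an annotated formula can be renamed consistently. *)
Definition tr (ax : axiom) : fo :=
  match ax with
  | GCI C D =>
      let: (phi, k) := tr_body C (inl 0%N) 1 in FImp phi (tr_head D (inl 0%N) k)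
  | RI rs r => FImp (tr_chain rs 0) (FRole r (inl 0%N) (inl (size rs)))
  | Dom r C => FImp (FRole r (inl 0%N) (inl 1%N)) (tr_head C (inl 0%N) 2)
  | Ran r C => FImp (FRole r (inl 0%N) (inl 1%N)) (tr_head C (inl 1%N) 2)
  | AConcept C a => tr_head C (inr a) 0
  | ARole r a b => FRole r (inr a) (inr b)
  end.

(* Only used with substitutions sending each variable to itself or to a
   constant, for which capture cannot occur. *)
Fixpoint fsubst (theta : nat -> term) (phi : fo) : fo :=
  let s t := if t is inl x then theta x else t in
  match phi with
  | FTrue => FTrue
  | FFalse => FFalse
  | FConcept A t => FConcept A (s t)
  | FRole r t u => FRole r (s t) (s u)
  | FEq t u => FEq (s t) (s u)
  | FPred _ _ fs t => FPred fs (s t)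
  | FAnd phi psi => FAnd (fsubst theta phi) (fsubst theta psi)
  | FImp phi psi => FImp (fsubst theta phi) (fsubst theta psi)
  | FEx y phi => FEx y (fsubst (fun z => if z == y then inl y else theta z) phi)
  end.

(* A concept or role atom over constants. *)
Definition gatom := (cname S * const S + rname S * const S * const S)%type.

Definition fo_of_gatom (a : gatom) : fo :=
  match a with
  | inl (A, c) => FConcept A (inr c)
  | inr (r, c, d) => FRole r (inr c) (inr d)
  end.

End Syntax.

Arguments FTrue {S}.
Arguments FFalse {S}.

Section Databases.
Variable S : signature.

Definition elt := (const S + null S)%type.

Definition cvalue := {j : cdom S & cd_val (cd j)}.

Inductive datom :=
| DConcept of cname S & elt
| DRole of rname S & elt & elt
| DFeature of fname S & elt & cvalue.

Definition db_domain (N : set (null S)) : set elt :=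
  fun e => match e with inl c => indiv c | inr n => N n end.

Definition datom_over (E : set elt) (a : datom) : Prop :=
  match a with
  | DConcept _ e => E e
  | DRole _ e e' => E e /\ E e'
  | DFeature _ e _ => E e
  end.

(* A database carries its own set of labeled nulls: the domain of
   quantification is I together with these, and constants denote themselves.
   No atom holds of a constant outside I.  Feature atoms make each feature a
   partial function into the disjoint union of the concrete domains. *)
Record db := Db {
  db_nulls : set (null S);
  db_atoms : set datom;
  db_nonempty : db_domain db_nulls !=set0;
  db_over : forall a, db_atoms a -> datom_over (db_domain db_nulls) a;
  db_functional : forall f e v v',
    db_atoms (DFeature f e v) -> db_atoms (DFeature f e v') -> v = v' }.

HB.instance Definition _ := gen_eqMixin db.
HB.instance Definition _ := gen_choiceMixin db.

Definition eval (sigma : nat -> elt) (t : term S) : elt :=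
  match t with inl x => sigma x | inr c => inl c end.

Fixpoint holds (D : db) (sigma : nat -> elt) (phi : fo S) : Prop :=
  match phi with
  | FTrue => True
  | FFalse => False
  | FConcept A t => db_atoms D (DConcept A (eval sigma t))
  | FRole r t u => db_atoms D (DRole r (eval sigma t) (eval sigma u))
  | FEq t u => eval sigma t = eval sigma u
  | FPred j p fs t =>
      exists2 vs : (cd_ar p).-tuple (cd_val (cd j)),
        forall i, db_atoms D
          (DFeature (tnth fs i) (eval sigma t)
             (existT (fun j => cd_val (cd j)) j (tnth vs i)))
        & cd_ext vs
  | FAnd phi psi => holds D sigma phi /\ holds D sigma psi
  | FImp phi psi => holds D sigma phi -> holds D sigma psi
  | FEx y phi => exists2 e, db_domain (db_nulls D) e
      & holds D (fun z => if z == y then e else sigma z) phi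
  end.

Definition models (D : db) (phi : fo S) : Prop :=
  forall sigma : nat -> elt,
    (forall x, db_domain (db_nulls D) (sigma x)) -> holds D sigma phi.

Definition entails (Gamma : set (fo S)) (phi : fo S) : Prop :=
  forall D : db, (forall psi, Gamma psi -> models D psi) -> models D phi.

End Databases.

Section Annotations.
Variable S : signature.

Definition mterm := (nat + mconst S)%type.

Definition matom := {p : mpred S & (mar p).-tuple mterm}.

(* The set X of ground atoms, i.e. of Boolean random variables. *)
Definition mgatom := {p : mpred S & (mar p).-tuple (mconst S)}.

Definition world := {ffun mgatom -> bool}.

Definition matom_of_mgatom (x : mgatom) : matom :=
  existT (fun p => (mar p).-tuple mterm) (tag x)
    (map_tuple (fun c => inr c : mterm) (tagged x)).

Definition matom_vars (A : matom) : set nat :=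
  [set x | (inl x : mterm) \in tval (tagged A)].

Definition msubst := nat -> mterm.

Definition tsubst (theta : msubst) (t : mterm) : mterm :=
  if t is inl x then theta x else t.

Definition asubst (theta : msubst) (A : matom) : matom :=
  existT (fun p => (mar p).-tuple mterm) (tag A)
    (map_tuple (tsubst theta) (tagged A)).

Definition unifier (theta : msubst) (E : set (matom * matom)) : Prop :=
  forall e, E e -> asubst theta e.1 = asubst theta e.2.

Definition mgu (theta : msubst) (E : set (matom * matom)) : Prop :=
  unifier theta E /\
  forall sigma, unifier sigma E ->
    exists rho : msubst, forall x, sigma x = tsubst rho (theta x).

Definition annotation := {fset (matom * bool)}.

Definition wf_annotation (mu : annotation) : Prop :=
  forall p q, p \in mu -> q \in mu -> p <> q ->
    ~ exists theta, unifier theta [set (p.1, q.1)].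

(* theta is a most general unifier for lambda and mu with theta mu included in
   lambda: each pair <A_i, x_i> of mu is matched with some X_i to which lambda
   assigns x_i, and theta is a most general simultaneous unifier of the A_i and
   the X_i.  As usual, theta is the identity outside the variables of mu. *)
Definition mgu_into (lambda : world) (mu : annotation) (theta : msubst) : Prop :=
  exists X : matom * bool -> mgatom,
    [/\ forall p, p \in mu -> lambda (X p) = p.2,
        mgu theta [set (p.1, matom_of_mgatom (X p)) | p in [set` mu]]
      & forall x, (forall p, p \in mu -> ~ matom_vars p.1 x) ->
          theta x = inl x].

Definition msubst_term (theta : msubst) (x : nat) : term S :=
  match theta x with inl y => inl y | inr c => inr (val c) end.

Definition world_annotation (lambda : world) : annotation :=
  [fset (matom_of_mgatom x, lambda x) | x : mgatom]%fset.

Definition ontology := {fset (axiom S * annotation)}.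

Definition ontology_axioms (O : ontology) : set (axiom S) :=
  [set p.1 | p in [set` O]].

Definition wf_ontology (O : ontology) : Prop :=
  [/\ forall p, p \in O -> all (@indiv S) (axiom_consts p.1),
      forall p, p \in O -> wf_annotation p.2
    & range_restriction (ontology_axioms O)].

Definition induced (O : ontology) (lambda : world) : set (fo S) :=
  [set phi | exists p theta,
     [/\ p \in O, mgu_into lambda p.2 theta
       & phi = fsubst (msubst_term theta) (tr p.1)]].

Definition kb_cnames (O : ontology) : seq (cname S) :=
  flatten [seq axiom_cnames p.1 | p <- enum_fset O].

Definition kb_rnames (O : ontology) : seq (rname S) :=
  flatten [seq axiom_rnames p.1 | p <- enum_fset O].

(* Elements of Delta_MLN can enter the induced ontologies through annotations;
   those that are individual names count as individuals of the ontology. *)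
Definition kb_indivs (O : ontology) : seq (const S) :=
  flatten [seq axiom_consts p.1 | p <- enum_fset O]
    ++ [seq c <- enum_fset (mconst S) | indiv c].

Definition kb_gatoms (O : ontology) : seq (gatom S) :=
  [seq inl (A, c) | A <- kb_cnames O, c <- kb_indivs O]
  ++ [seq inr (r, cd.1, cd.2) | r <- kb_rnames O,
        cd <- [seq (c, d) | c <- kb_indivs O, d <- kb_indivs O]].

Definition atomic_consequences (O : ontology) (lambda : world)
    : {fset gatom S} :=
  [fset a in kb_gatoms O | `[< entails (induced O lambda) (fo_of_gatom a) >]]%fset.

End Annotations.

Section MarkovLogic.
Variables (R : realType) (S : signature).

(* A conjunction is given by the list of its conjuncts. *)
Definition conj := seq (mgatom S).

Definition sat (lambda : world S) (F : conj) : bool := all lambda F.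

Definition mln := {fset (conj * R)}.

Variable M : mln.

Definition weight (lambda : world S) : R :=
  expR (\sum_(j : M | sat lambda (val j).1) (val j).2).

Definition pr_mln (lambda : world S) : R :=
  weight lambda / \sum_(lambda' : world S) weight lambda'.

(* An equivalence class is identified with the set T of the formulas of M that
   hold in it; the set of its worlds may be empty. *)
Definition eqclass := {set M}.

Definition class_worlds (T : eqclass) : {set world S} :=
  [set lambda : world S | [forall j : M, sat lambda (val j).1 == (j \in T)]].

Definition class_score (T : eqclass) : R :=
  expR (\sum_(j in T) (val j).2).

End MarkovLogic.

Section Semantics.
Variables (R : realType) (S : signature).

Definition interp := (db S * world S)%type.

Definition isat (I : interp) (F : fo S) (mu : annotation S) : Prop :=
  forall theta, mgu_into I.2 mu theta ->
    models I.1 (fsubst (msubst_term theta) F).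

Definition prob_interp (Pr : interp -> R) : Prop :=
  [/\ forall I, 0 <= Pr I,
      finite_set [set I | Pr I != 0]
    & \sum_(I \in [set: interp]) Pr I = 1].

Definition pr_of (Pr : interp -> R) (F : fo S) (mu : annotation S) : R :=
  \sum_(I \in [set I | isat I F mu]) Pr I.

Definition pr_models (O : ontology S) (M : mln R S) (Pr : interp -> R) : Prop :=
  [/\ prob_interp Pr,
      forall p, p \in O -> pr_of Pr (tr p.1) p.2 = 1
    & forall lambda : world S,
        1 - pr_of Pr FFalse (world_annotation lambda) = pr_mln M lambda].

(* The infimum is +oo if the knowledge base has no model. *)
Definition pr_kb (O : ontology S) (M : mln R S) (a : gatom S) : \bar R :=
  ereal_inf [set (pr_of Pr (fo_of_gatom a) fset0)%:E | Pr in pr_models O M].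

End Semantics.

Section Algorithm.
Variables (R : realType) (S : signature) (O : ontology S) (M : mln R S).

(* [st_worlds] and [st_classes] count the worlds and the classes analyzed. *)
Record state := State {
  st_score : gatom S -> R;
  st_out : {fset gatom S};
  st_worlds : nat;
  st_classes : nat }.

Definition init_state : state := State (fun=> 0) fset0 0 0.

Definition inspect (C : eqclass M) (lambda : world S) (st : state) : state :=
  let cons := atomic_consequences O lambda in
  State (fun a => if a \in cons then st_score st a + class_score C
                  else st_score st a)
        (st_out st `|` cons)%fset (st_worlds st).+1 (st_classes st).

Definition close_class (st : state) : state :=
  State (st_score st) (st_out st) (st_worlds st) (st_classes st).+1.

(* The stopping condition is tested before each world and before each class.
   If it interrupts [run_class], the test in [run_classes] sees the same state,
   so that the whole run ends. *)
Fixpoint run_class (stop : state -> bool) (C : eqclass M)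
    (ws : seq (world S)) (st : state) : state :=
  if ws is lambda :: ws' then
    if stop st then st else run_class stop C ws' (inspect C lambda st)
  else close_class st.

Fixpoint run_classes (stop : state -> bool) (worlds : eqclass M -> seq (world S))
    (Cs : seq (eqclass M)) (st : state) : state :=
  if Cs is C :: Cs' then
    if stop st then st
    else run_classes stop worlds Cs' (run_class stop C (worlds C) st)
  else st.

Definition anytimeRank (Cs : seq (eqclass M))
    (worlds : eqclass M -> seq (world S)) (stop : state -> bool) : state :=
  run_classes stop worlds Cs init_state.

Definition ranking (st : state) : seq (gatom S * R) :=
  sort (fun p q => q.2 <= p.2) [seq (a, st_score st a) | a <- enum_fset (st_out st)].

(* The class C_(t+1) has index t in Cs.  If t = size Cs, every world has been
   inspected and the first factor is 0. *)
Definition unassigned_bound (Cs : seq (eqclass M)) (st : state) : R :=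
  (2 ^+ #|{: mgatom S}| - (st_worlds st)%:R)
    * class_score (nth finset.set0 Cs (st_classes st)).

Definition leU (out : seq (gatom S * R)) (U : R) (a b : gatom S) : Prop :=
  exists sa sb, [/\ (a, sa) \in out, (b, sb) \in out & sa + U <= sb].

End Algorithm.

(* Main.v *)
Require Import Defs.
From mathcomp Require Import all_boot all_order all_algebra finmap.
From mathcomp Require Import all_classical all_reals all_analysis.
From mathcomp Require Import lra.

Set Implicit Arguments.
Unset Strict Implicit.
Unset Printing Implicit Defensive.

Import Order.TTheory GRing.Theory Num.Theory.
Local Open Scope ring_scope.

(** Let P(a) be the total probability of the worlds [l] whose induced ontology
    entails [a].  In a model of the knowledge base, almost every interpretation
    with world [l] satisfies O_l, so the probability of [a] is at least P(a).
    If a model exists, every O_l is satisfiable, and giving all the mass of [l]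
    to one database that satisfies O_l and, whenever possible, falsifies [a]
    produces a model with probability at most P(a).  If there is no model, all
    the infima are +oo.  Either way P(a) <= P(b) suffices.

    The worlds seen by the algorithm form a prefix of the concatenation of the
    classes, so s_a is the weight of the seen worlds that entail [a], and every
    unseen world weighs at most the score of the class C_(t+1).  Hence
    s_a <= Z P(a) <= s_a + U, and s_a + U <= s_b gives P(a) <= P(b). *)

(** * Entailment probability and the worlds inspected by a run *)

Definition entail_prob (R : realType) (S : signature) (O : ontology S)
    (M : mln R S) (a : gatom S) : R :=
  \sum_(l : world S | `[< entails (Defs.induced O l) (fo_of_gatom a) >]) pr_mln M l.

(** Invariant of the run, with [seen] the inspected worlds in order. The last clause is needed
    because [atomic_consequences] keeps only atoms of [kb_gatoms]: for an output atom, being listed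
    there is the same as being entailed. *)
Definition analyzed (R : realType) (S : signature) (O : ontology S)
    (M : mln R S) (seen : seq (world S)) (st : state R S) : Prop :=
  [/\ forall a, st_score st a =
        \sum_(l <- seen | a \in atomic_consequences O l) weight M l,
      st_worlds st = size seen
    & {subset st_out st <= kb_gatoms O}].

Lemma in_class_worlds (R : realType) (S : signature) (M : mln R S)
    (T : eqclass M) (l : world S) :
  (l \in class_worlds T) =
    (T == [set j : M | sat l (val j).1]%SET).
Proof.
rewrite inE; apply/forallP/eqP => [lT|-> j]; last by rewrite inE.
by apply/setP => j; rewrite inE (eqP (lT j)).
Qed.

Lemma class_score_weight (R : realType) (S : signature) (M : mln R S)
    (T : eqclass M) (l : world S) :
  l \in class_worlds T -> class_score T = weight M l.
Proof.
rewrite in_class_worlds => /eqP ->; rewrite /class_score /weight.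
by congr expR; apply: eq_bigl => j; rewrite inE.
Qed.

Lemma inspect_analyzed (R : realType) (S : signature) (O : ontology S)
    (M : mln R S) (C : eqclass M) (l : world S) seen (st : state R S) :
  l \in class_worlds C -> analyzed O M seen st ->
  analyzed O M (rcons seen l) (inspect O C l st).
Proof.
move=> lC [sc sz out]; split => /=; last 2 first.
- by rewrite size_rcons sz.
- move=> a; rewrite in_fsetU => /orP[/out//|].
  by rewrite in_fset inE => /andP[].
move=> a; rewrite -cats1 big_cat/= big_cons big_nil sc (class_score_weight lC).
by case: ifP; rewrite ?addr0.
Qed.

(** The final disjunction tells the caller whether the class was finished and counted, or whether
    [stop] holds in the resulting state, so that the outer loop ends as well. *)
Lemma run_class_prefix (R : realType) (S : signature) (O : ontology S)
    (M : mln R S) (stop : state R S -> bool) (C : eqclass M) ws seen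
    (st : state R S) :
  {subset ws <= class_worlds C} -> analyzed O M seen st ->
  let st' := run_class O stop C ws st in
  exists pre post, [/\ ws = pre ++ post, analyzed O M (seen ++ pre) st'
    & (post = [::] /\ st_classes st' = (st_classes st).+1) \/
      (stop st' /\ st_classes st' = st_classes st)].
Proof.
elim: ws seen st => [|l ws IH] seen st wsC an /=.
  by exists [::], [::]; rewrite (cats0 seen); split=> //; left.
case: ifP => [stp|_].
  by exists [::], (l :: ws); rewrite cats0; split=> //; right.
have lC : l \in class_worlds C by apply: wsC; rewrite mem_head.
have [||pre [post [-> an' cl]]] := IH (rcons seen l) (inspect O C l st).
- by move=> x xws; apply: wsC; rewrite inE xws orbT.
- exact: inspect_analyzed.
by exists (l :: pre), post; split=> //; rewrite -cat_rcons.
Qed.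

(** The number [k] counts the classes closed by this call. The last clause, that their worlds have
    all been seen, is what later places an unseen world in a class of index at least
    [st_classes]. *)
Lemma run_classes_prefix (R : realType) (S : signature) (O : ontology S)
    (M : mln R S) (stop : state R S -> bool)
    (worlds : eqclass M -> seq (world S)) Cs seen (st : state R S) :
  (forall C, {subset worlds C <= class_worlds C}) -> analyzed O M seen st ->
  let st' := run_classes O stop worlds Cs st in
  exists pre post k, [/\ flatten (map worlds Cs) = pre ++ post,
    analyzed O M (seen ++ pre) st', st_classes st' = (st_classes st + k)%N
    & {subset flatten (map worlds (take k Cs)) <= pre}].
Proof.
move=> wC; elim: Cs seen st => [|C Cs IH] seen st an /=.
  by exists [::], [::], 0%N; rewrite (cats0 seen) addn0.
case: ifP => [stp|_].
  exists [::], (worlds C ++ flatten (map worlds Cs)), 0%N.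
  by rewrite cats0 addn0.
have [pre [post [eC an1]]] := run_class_prefix stop (wC C) an.
set st1 := run_class _ _ _ _ _ in an1 *; rewrite eC; case=> [[e0 cl]|[stp cl]].
  have [pre' [post' [k [-> an2 cl2 sub]]]] := IH _ _ an1.
  exists (pre ++ pre'), post', k.+1; rewrite e0 cats0 (catA seen); split=> //.
  - by rewrite catA.
  - by rewrite cl2 cl addSnnS.
  by move=> x; rewrite /= eC e0 cats0 !mem_cat => /orP[->//|/sub->]; rewrite orbT.
(* Interrupted inside [C]: no class is closed, so [k] is 0, and the next test of [stop] leaves all
   later classes unseen. *)
exists pre, (post ++ flatten (map worlds Cs)), 0%N; rewrite addn0 catA take0.
by case: Cs {IH} => [|C' Cs] /=; rewrite ?stp.
Qed.

Lemma anytimeRank_prefix (R : realType) (S : signature) (O : ontology S)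
    (M : mln R S) (stop : state R S -> bool)
    (worlds : eqclass M -> seq (world S)) Cs :
  (forall C, {subset worlds C <= class_worlds C}) ->
  let st := anytimeRank O Cs worlds stop in
  exists pre post, [/\ flatten (map worlds Cs) = pre ++ post,
    analyzed O M pre st
    & {subset flatten (map worlds (take (st_classes st) Cs)) <= pre}].
Proof.
move=> wC /=; have an0 : analyzed O M [::] (init_state R S).
  by split=> // a; rewrite big_nil.
have [pre [post [k [e an cl sub]]]] := run_classes_prefix stop Cs wC an0.
by exists pre, post; split=> //; rewrite /anytimeRank cl.
Qed.

(** * Weights of the unseen worlds and bounds on the scores *)

Lemma flatten_worlds_uniq (R : realType) (S : signature) (M : mln R S)
    (worlds : eqclass M -> seq (world S)) Cs :
  (forall C, perm_eq (worlds C) (enum (class_worlds C))) -> uniq Cs ->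
  uniq (flatten (map worlds Cs)).
Proof.
move=> wE; elim: Cs => //= C Cs IH /andP[CCs /IH uCs].
rewrite cat_uniq uCs (perm_uniq (wE C)) enum_uniq andbT.
apply/hasPn => l /flattenP[_ /mapP[C' C'Cs ->]].
rewrite !(perm_mem (wE _)) !mem_enum !in_class_worlds => /eqP eC'.
by apply: contra CCs => /eqP ->; rewrite -eC'.
Qed.

Lemma unseen_weight_le (R : realType) (S : signature) (M : mln R S)
    (worlds : eqclass M -> seq (world S)) Cs k (l : world S) :
  perm_eq Cs (enum [set: eqclass M]) ->
  sorted (fun C C' => class_score C' <= class_score C) Cs ->
  (forall C, perm_eq (worlds C) (enum (class_worlds C))) ->
  l \notin flatten (map worlds (take k Cs)) ->
  weight M l <= class_score (nth finset.set0 Cs k).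
Proof.
move=> CsE Cs_sorted wE nl.
pose T : eqclass M := [set j : M | sat l (val j).1]%SET.
have lT : l \in class_worlds T by rewrite in_class_worlds.
have TCs : T \in Cs by rewrite (perm_mem CsE) mem_enum inE.
(* The class [T] of [l] is not among the first [k], whose worlds are all listed. As [T] occurs in
   [Cs], this also gives [k < size Cs], so the default of [nth] is never read. *)
have kT : (k <= index T Cs)%N.
  rewrite leqNgt; apply: contra nl => kT; apply/flattenP; exists (worlds T).
    by apply: map_f; rewrite in_take.
  by rewrite (perm_mem (wE T)) mem_enum.
rewrite -(class_score_weight lT) -{1}(nth_index finset.set0 TCs).
apply: (sorted_leq_nth _ _ _ Cs_sorted) => //.
- by move=> x y z xy yz; exact: le_trans yz xy.
- by rewrite inE (leq_ltn_trans kT) ?index_mem.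
- by rewrite inE index_mem.
Qed.

Lemma card_world (S : signature) : #|{: world S}| = (2 ^ #|{: mgatom S}|)%N.
Proof. by rewrite card_ffun card_bool. Qed.

Lemma weight_gt0 (R : realType) (S : signature) (M : mln R S) (l : world S) :
  0 < weight M l.
Proof. exact: expR_gt0. Qed.

Lemma sum_weight_gt0 (R : realType) (S : signature) (M : mln R S) :
  0 < \sum_(l : world S) weight M l.
Proof.
rewrite (bigD1 [ffun=> false])//= ltr_wpDr ?weight_gt0// sumr_ge0// => l _.
exact/ltW/weight_gt0.
Qed.

Lemma pr_mln_gt0 (R : realType) (S : signature) (M : mln R S) (l : world S) :
  0 < pr_mln M l.
Proof. by rewrite divr_gt0 ?weight_gt0 ?sum_weight_gt0. Qed.

Lemma sum_pr_mln (R : realType) (S : signature) (M : mln R S) :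
  \sum_(l : world S) pr_mln M l = 1.
Proof. by rewrite -mulr_suml mulfV// gt_eqF// sum_weight_gt0. Qed.

Lemma analyzed_scoreE (R : realType) (S : signature) (O : ontology S)
    (M : mln R S) seen (st : state R S) a :
  analyzed O M seen st -> a \in st_out st ->
  st_score st a =
    \sum_(l <- seen | `[< entails (Defs.induced O l) (fo_of_gatom a) >]) weight M l.
Proof.
move=> [sc _ out] /out aO; rewrite sc; apply: eq_bigl => l.
by rewrite /atomic_consequences !inE/= aO.
Qed.

Lemma unassigned_bound_ge (R : realType) (S : signature) (O : ontology S)
    (M : mln R S) (Cs : seq (eqclass M)) seen (st : state R S) :
  analyzed O M seen st -> uniq seen ->
  (forall l, l \notin seen ->
    weight M l <= class_score (nth finset.set0 Cs (st_classes st))) ->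
  \sum_(l | l \notin seen) weight M l <= unassigned_bound Cs st.
Proof.
move=> [_ sz _] us wle; apply: (le_trans (ler_sum _ wle)).
rewrite sumr_const -mulr_natl /unassigned_bound sz -natrX -card_world.
(* Distinct seen worlds cannot outnumber all worlds, so the subtraction in [nat] does not truncate
   and counts the unseen ones. *)
rewrite -natrB; last by rewrite -(card_uniqP us) max_card.
by rewrite -(card_uniqP us) -(cardC (mem seen)) addKn.
Qed.

(** Multiplying by the normalization constant turns the probability into the weight of the entailing
    worlds; the seen ones make up the score, the unseen ones weigh at most the bound. *)
Lemma score_bounds (R : realType) (S : signature) (O : ontology S)
    (M : mln R S) (Cs : seq (eqclass M)) seen (st : state R S) a :
  analyzed O M seen st -> uniq seen ->
  (forall l, l \notin seen ->
    weight M l <= class_score (nth finset.set0 Cs (st_classes st))) ->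
  a \in st_out st ->
  st_score st a <= entail_prob O M a * \sum_(l : world S) weight M l
    <= st_score st a + unassigned_bound Cs st.
Proof.
move=> an us wle aout.
pose P l := `[< entails (Defs.induced O l) (fo_of_gatom a) >].
have -> : entail_prob O M a * \sum_(l : world S) weight M l =
    \sum_(l | P l) weight M l.
  rewrite /entail_prob /pr_mln -mulr_suml -mulrA mulVf ?mulr1// gt_eqF//.
  exact: sum_weight_gt0.
have -> : st_score st a = \sum_(l | P l && (l \in seen)) weight M l.
  rewrite (analyzed_scoreE an aout) big_mkcond big_uniq// -big_mkcondr.
  by apply: eq_bigl => l; rewrite andbC.
rewrite (bigID (mem seen) P)/= lerDl sumr_ge0 => [/=|l _]; last first.
  exact/ltW/weight_gt0.
rewrite lerD2l; apply: le_trans (unassigned_bound_ge an us wle).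
rewrite [leRHS](bigID P)/=; under eq_bigl do rewrite andbC.
by rewrite lerDl sumr_ge0// => l _; exact/ltW/weight_gt0.
Qed.

(** * Sums of finite support, matching of annotations, satisfaction *)

Lemma fsbig_seq_cond (R : nmodType) (I : choiceType) (A : set I) (s : seq I)
    (F : I -> R) :
  uniq s -> (forall i, i \notin s -> F i = 0) ->
  \sum_(i \in A) F i = \sum_(i <- s | i \in A) F i.
Proof.
move=> us F0; rewrite (@fsbigE _ _ _ _ A [seq i <- s | i \in A])//.
- by rewrite big_filter_cond; apply: eq_bigl => i; rewrite andbb.
- by rewrite filter_uniq.
- by move=> i; rewrite /= mem_filter => /andP[/set_mem].
- move=> i Ai; rewrite mem_filter negb_and mem_set//=; exact: F0.
Qed.

Lemma asubst_ground (S : signature) theta (x : mgatom S) :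
  asubst theta (matom_of_mgatom x) = matom_of_mgatom x.
Proof.
by rewrite /asubst /=; congr existT; apply: val_inj; rewrite /= -map_comp.
Qed.

Lemma matom_of_mgatom_inj (S : signature) : injective (@matom_of_mgatom S).
Proof.
move=> [p t] [q u] e; have epq : p = q by have /= := congr1 tag e.
case: q / epq u e => u e.
have {}e := congr1 val (eq_from_Tagged e).
by congr existT; apply: val_inj; apply: (inj_map _ e) => ? ? [].
Qed.

(* [X] matters: if there are atoms with variables but no ground atom, no such
   map exists, [mgu_into] never holds, and no knowledge base has a model. *)
Lemma mgu_world_annotation (S : signature) (X : matom S * bool -> mgatom S)
    (w l : world S) :
  (exists theta, mgu_into w (world_annotation l) theta) <-> w = l.
Proof.
split=> [[theta [Y [wY [thetaY _] _]]]|->].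
  (* Substitutions fix ground atoms, so the atom matched with [x] can only be [x] itself. *)
  apply/ffunP => x; pose p := (matom_of_mgatom x, l x).
  have pl : p \in world_annotation l by apply/imfsetP; exists x.
  suff xY : x = Y p by rewrite [in LHS]xY (wY _ pl).
  apply: matom_of_mgatom_inj; rewrite -[LHS](asubst_ground theta).
  by rewrite (thetaY (p.1, matom_of_mgatom (Y p))) ?asubst_ground//; exists p.
(* [Y] recovers the ground atom from a pair of the annotation; [X] only supplies values on other
   pairs. *)
pose Y p := if pselect (exists x, p = (matom_of_mgatom x, l x)) is left e
  then sval (cid e) else X p.
have YE p : p \in world_annotation l -> p = (matom_of_mgatom (Y p), l (Y p)).
  move=> /imfsetP[x _ px]; rewrite /Y; case: pselect => [e|[]]; last by exists x.
  by case: (cid e).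
exists inl, Y; split => //.
- by move=> p /YE {2}->.
- split=> [e [p /YE pE <-]|sigma _]; last by exists sigma.
  by rewrite [in LHS]pE/=.
Qed.

(** A database has a nonempty domain, hence an assignment of the variables, and so never models
    [FFalse]. *)
Lemma isat_false (S : signature) (I : interp S) (mu : annotation S) :
  isat I FFalse mu <-> ~ exists theta, mgu_into I.2 mu theta.
Proof.
split=> [sat [theta /sat]|nmgu theta th]; last by case: nmgu; exists theta.
have [e De] := db_nonempty I.1.
by move=> /(_ (fun=> e)); apply.
Qed.

Lemma fsubst_gatom (S : signature) theta (a : gatom S) :
  fsubst theta (fo_of_gatom a) = fo_of_gatom a.
Proof. by case: a => [[? ?]|[[? ?] ?]]. Qed.

Lemma mgu_into0 (S : signature) (X : matom S * bool -> mgatom S) (w : world S) :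
  mgu_into w fset0 inl.
Proof.
exists X; split=> //; split=> [e [p]|sigma _]; first by rewrite /= inE.
by exists sigma.
Qed.

Lemma isat_gatom (S : signature) (X : matom S * bool -> mgatom S)
    (I : interp S) (a : gatom S) :
  isat I (fo_of_gatom a) fset0 <-> models I.1 (fo_of_gatom a).
Proof.
split=> [/(_ inl (mgu_into0 X _))|Ia theta _]; by rewrite fsubst_gatom.
Qed.

Lemma models_induced (S : signature) (O : ontology S) (I : interp S) :
  (forall p, p \in O -> isat I (tr p.1) p.2) <->
  (forall phi, Defs.induced O I.2 phi -> models I.1 phi).
Proof.
split=> [sat phi [p [theta [pO th ->]]]|sat p pO theta th].
  exact: sat th.
by apply: sat; exists p, theta.
Qed.

(** * Models of the knowledge base *)

Lemma prob_interp_support (R : realType) (S : signature) (Pr : interp S -> R) :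
  prob_interp Pr -> exists s : seq (interp S),
    uniq s /\ forall I, I \notin s -> Pr I = 0.
Proof.
move=> [_ fin _]; exists (enum_fset (fset_set [set I | Pr I != 0])).
split=> [|I]; first exact: fset_uniq.
rewrite in_fset_set// => /negP nI; apply/eqP/negPn/negP => PI.
by apply: nI; rewrite inE.
Qed.

(** The complement of an event of probability 1 has mass 0, and a vanishing sum of nonnegative terms
    has only zero terms. *)
Lemma prob_interp_as (R : realType) (S : signature) (Pr : interp S -> R)
    (A : set (interp S)) (I : interp S) :
  prob_interp Pr -> \sum_(J \in A) Pr J = 1 -> Pr I != 0 -> A I.
Proof.
move=> prPr; have [s [us s0]] := prob_interp_support prPr.
case: prPr => Pr0 _; rewrite !(fsbig_seq_cond _ us s0) => sumT sumA PI.
have Is : I \in s by apply: contraNT PI => /s0 ->.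
move: sumT; under eq_bigl do rewrite in_setT.
rewrite (bigID (fun J => J \in A))/= sumA => /eqP.
rewrite -subr_eq0 addrAC subrr add0r psumr_eq0// => /allP/(_ _ Is)/=.
by rewrite (negbTE PI) implybF negbK => /set_mem.
Qed.

Lemma pr_of_world (R : realType) (S : signature) (Pr : interp S -> R)
    (X : matom S * bool -> mgatom S) (l : world S) (s : seq (interp S)) :
  prob_interp Pr -> uniq s -> (forall I, I \notin s -> Pr I = 0) ->
  1 - pr_of Pr FFalse (world_annotation l) = \sum_(I <- s | I.2 == l) Pr I.
Proof.
move=> [_ _]; rewrite /pr_of => + us s0; rewrite !(fsbig_seq_cond _ us s0) => <-.
under eq_bigl do rewrite in_setT.
rewrite (bigID (fun I => I.2 == l))/= -addrA [X in _ + X](_ : _ = 0) ?addr0//.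
apply/eqP; rewrite subr_eq0; apply/eqP/eq_bigl => I; apply/idP/idP.
  by move=> /eqP Il; rewrite inE; apply/isat_false => /(mgu_world_annotation X).
rewrite inE => /isat_false nI; apply/eqP => Il; apply: nI.
exact/(mgu_world_annotation X).
Qed.

(** Without such a map no annotation is ever matched, so every interpretation satisfies [FFalse]
    under a world annotation and that world gets mass 0, against [pr_mln_gt0]. *)
Lemma pr_models_inhabited (R : realType) (S : signature) (O : ontology S)
    (M : mln R S) (Pr : interp S -> R) :
  pr_models O M Pr -> exists X : matom S * bool -> mgatom S, True.
Proof.
move=> [prPr _ /(_ [ffun=> false]) prl]; apply: contrapT => nX.
have [_ _ sumT] := prPr.
have := pr_mln_gt0 M [ffun=> false]; rewrite -prl /pr_of.
suff -> : [set I | isat I FFalse (world_annotation [ffun=> false])]%classic =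
    [set: interp S]%classic.
  by rewrite sumT subrr ltxx.
apply/seteqP; split=> // I _; apply/isat_false => -[theta [X _]].
by apply: nX; exists X.
Qed.

Lemma entail_prob_le (R : realType) (S : signature) (O : ontology S)
    (M : mln R S) (Pr : interp S -> R) (a : gatom S) :
  pr_models O M Pr -> entail_prob O M a <= pr_of Pr (fo_of_gatom a) fset0.
Proof.
move=> PrKB; have [X _] := pr_models_inhabited PrKB.
case: PrKB => prPr PrO PrM; have [s [us s0]] := prob_interp_support prPr.
rewrite /entail_prob /pr_of (fsbig_seq_cond _ us s0).
under eq_bigr do rewrite -PrM (pr_of_world X _ prPr us s0).
(* With the sums exchanged, each interpretation [I] counts only for its own world [I.2]. *)
rewrite (exchange_big_dep xpredT)//= [leRHS]big_mkcond; apply: ler_sum => I _.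
have [PI|PI] := eqVneq (Pr I) 0.
  by rewrite PI big1 ?if_same.
rewrite big_mkcondl/= (big_pred1 I.2) => [|l]; last by rewrite eq_sym.
case: ifP => [/asboolP ent|_]; last by case: ifP => // _; case: prPr.
rewrite mem_set//; apply/(isat_gatom X); apply: ent.
by apply/models_induced => p /PrO sat; exact: (prob_interp_as prPr sat PI).
Qed.

Lemma pr_models_induced (R : realType) (S : signature) (O : ontology S)
    (M : mln R S) (Pr : interp S -> R) (l : world S) :
  pr_models O M Pr ->
  exists D : db S, forall phi, Defs.induced O l phi -> models D phi.
Proof.
move=> PrKB; have [X _] := pr_models_inhabited PrKB.
case: PrKB => prPr PrO PrM; have [s [us s0]] := prob_interp_support prPr.
have : 0 < \sum_(I <- s | I.2 == l) Pr I.
  by rewrite -(pr_of_world X _ prPr us s0) PrM pr_mln_gt0.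
rewrite lt0r => /andP[sum0 _].
have [I /andP[/eqP Il PI]] : exists I, (I.2 == l) && (Pr I != 0).
  apply: contrapT => nI; case/eqP: sum0; apply: big1 => I Il; apply/eqP.
  by apply: contraT => PI; case: nI; exists I; rewrite Il.
exists I.1; rewrite -Il; apply/models_induced => p /PrO sat.
exact: (prob_interp_as prPr sat PI).
Qed.

Lemma pr_kb_le (R : realType) (S : signature) (O : ontology S)
    (M : mln R S) (Pr : interp S -> R) (a : gatom S) :
  pr_models O M Pr -> (pr_kb O M a <= (entail_prob O M a)%:E)%E.
Proof.
move=> PrKB; have [X _] := pr_models_inhabited PrKB.
(* [D l] is a model of the induced ontology that falsifies [a] unless [a] is entailed; in the
   entailed case [pr_models_induced] provides it. *)
have /choice[D DP] (l : world S) : exists D : db S,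
    (forall phi, Defs.induced O l phi -> models D phi) /\
    (models D (fo_of_gatom a) -> entails (Defs.induced O l) (fo_of_gatom a)).
  have [ent|/existsNP[D /not_implyP[DO Da]]] :=
    pselect (entails (Defs.induced O l) (fo_of_gatom a)); last by exists D.
  by have [D DO] := pr_models_induced l PrKB; exists D.
pose Pr' (I : interp S) := if I.1 == D I.2 then pr_mln M I.2 else 0.
pose s := [seq (D l, l) | l <- enum {: world S}].
have us : uniq s by rewrite map_inj_uniq ?enum_uniq// => ? ? [].
have s0 (I : interp S) : I \notin s -> Pr' I = 0.
  case: I => [E l] nI; rewrite /Pr'/=; case: eqP => // El.
  by case/mapP: nI; exists l; rewrite ?mem_enum// El.
have Pr'E (A : set (interp S)) :
    \sum_(I \in A) Pr' I = \sum_(l | (D l, l) \in A) pr_mln M l.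
  rewrite (fsbig_seq_cond _ us s0) big_map big_enum_cond/=.
  by apply: eq_bigr => l _; rewrite /Pr'/= eqxx.
have prPr' : prob_interp Pr'.
  split=> [I||].
  - by rewrite /Pr'; case: ifP => // _; exact/ltW/pr_mln_gt0.
  - apply: (@sub_finite_set _ _ [set` s]); last exact: finite_seq.
    by move=> I /= PI; apply: contraNT PI => /s0 ->.
  - by rewrite Pr'E -[RHS](sum_pr_mln M); apply: eq_bigl => l; rewrite in_setT.
apply: (@le_trans _ _ (pr_of Pr' (fo_of_gatom a) fset0)%:E).
  apply: ereal_inf_lbound; exists Pr' => //; split=> // [p pO|l].
    rewrite /pr_of Pr'E -[RHS](sum_pr_mln M); apply: eq_bigl => l.
    by rewrite mem_set//; apply/models_induced : p pO; case: (DP l).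
  rewrite (pr_of_world X _ prPr' us s0) big_map big_enum_cond/=.
  by rewrite big_pred1_eq /Pr'/= eqxx.
rewrite lee_fin /pr_of Pr'E big_mkcond [leRHS]big_mkcond; apply: ler_sum => l _.
case: ifP => [/set_mem/(isat_gatom X)/(proj2 (DP l)) ent|_].
  by rewrite asboolT.
by case: ifP => // _; exact/ltW/pr_mln_gt0.
Qed.

(** One model [Pr] serves twice: it bounds its own value at [b] from below, and its existence
    triggers [pr_kb_le] for [a]. With no model there is nothing to check. *)
Lemma pr_kb_mono (R : realType) (S : signature) (O : ontology S)
    (M : mln R S) (a b : gatom S) :
  entail_prob O M a <= entail_prob O M b -> (pr_kb O M a <= pr_kb O M b)%E.
Proof.
move=> ab; apply: le_ereal_inf_tmp => _ [Pr PrKB <-].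
apply: le_trans (pr_kb_le a PrKB) _; rewrite lee_fin.
exact: le_trans ab (entail_prob_le b PrKB).
Qed.

(** * The ranking and the order on it *)

Lemma mem_ranking (R : realType) (S : signature) (st : state R S) a s :
  ((a, s) \in ranking st) = (a \in st_out st) && (s == st_score st a).
Proof.
rewrite /ranking mem_sort; apply/mapP/andP => [[x xs [-> ->]]|[aout /eqP ->]].
  by rewrite eqxx.
by exists a.
Qed.

Lemma leU_rankingP (R : realType) (S : signature) (st : state R S) U a b :
  leU (ranking st) U a b <->
  [/\ a \in st_out st, b \in st_out st & st_score st a + U <= st_score st b].
Proof.
split=> [[sa [sb []]]|[aout bout ab]].
  by rewrite !mem_ranking => /andP[-> /eqP ->] /andP[-> /eqP ->].
by exists (st_score st a), (st_score st b); rewrite !mem_ranking aout bout !eqxx.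
Qed.

Theorem theorem6 (R : realType) (S : signature) (O : ontology S) (M : mln R S)
    (wf_O : wf_ontology O)
    (Cs : seq (eqclass M))
    (Cs_all : perm_eq Cs (enum [set: eqclass M]))
    (Cs_sorted : sorted (fun C C' => class_score C' <= class_score C) Cs)
    (worlds : eqclass M -> seq (world S))
    (worlds_all : forall C, perm_eq (worlds C) (enum (class_worlds C)))
    (stop : state R S -> bool) :
  let st := anytimeRank O Cs worlds stop in
  let out := ranking st in
  let U := unassigned_bound Cs st in
  [/\ forall a b c, leU out U a b -> leU out U b c -> leU out U a c,
      0 < U -> forall a, ~ leU out U a a,
      forall a b, leU out U a b -> leU out U b a ->
        exists s, (a, s) \in out /\ (b, s) \in out,
      U = 0 -> forall a s, (a, s) \in out -> leU out U a a
    & forall a b, leU out U a b -> (pr_kb O M a <= pr_kb O M b)%E].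
Proof.
move=> st out U.
have wC C : {subset worlds C <= class_worlds C}.
  by move=> l; rewrite (perm_mem (worlds_all C)) mem_enum.
have [seen [rest [e an sub]]] := anytimeRank_prefix O stop Cs wC.
rewrite -/st in an sub.
have uCs : uniq Cs by rewrite (perm_uniq Cs_all) enum_uniq.
have us : uniq seen.
  by have := flatten_worlds_uniq worlds_all uCs; rewrite e cat_uniq => /and3P[].
have wle l : l \notin seen ->
    weight M l <= class_score (nth finset.set0 Cs (st_classes st)).
  move=> nl; apply: (unseen_weight_le Cs_all Cs_sorted worlds_all).
  by apply: contra nl => /sub.
(* Nonnegativity gives transitivity, and antisymmetry up to ties: mutual comparison forces equal
   scores. *)
have U0 : 0 <= U.
  apply: le_trans (unassigned_bound_ge an us wle).
  by apply: sumr_ge0 => l _; exact/ltW/weight_gt0.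
split.
- move=> a b c /leU_rankingP[aout bout ab] /leU_rankingP[_ cout bc].
  apply/leU_rankingP; split=> //; lra.
- move=> Upos a /leU_rankingP[_ _]; lra.
- move=> a b /leU_rankingP[aout bout ab] /leU_rankingP[_ _ ba].
  exists (st_score st a); rewrite !mem_ranking aout bout eqxx/=; split=> //.
  apply/eqP; lra.
- move=> Uz a s; rewrite mem_ranking => /andP[aout _].
  by apply/leU_rankingP; rewrite Uz addr0.
move=> a b /leU_rankingP[aout bout ab]; apply: pr_kb_mono.
(* Scores are not normalized, so both probabilities are scaled by the total weight before
   comparison. *)
rewrite -(ler_pM2r (sum_weight_gt0 M)).
have /andP[_ sa] := score_bounds an us wle aout.
have /andP[sb _] := score_bounds an us wle bout.
exact: le_trans sa (le_trans ab sb).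
Qed.
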